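(* Let $(N,[\cdot,\ldots,\cdot],\alpha)$ be a multiplicative $n$-ary Hom-Nambu superalgebra with bijective twisting map $\alpha$. For every $k\in\mathbb{Z}$, define $[x_1,\ldots,x_n]_{\alpha^k}=\alpha^k([x_1,\ldots,x_n])$ and set $N_{\alpha^k}=(N,[\cdot,\ldots,\cdot]_{\alpha^k},\alpha^{k+1})$. Then $N_{\alpha^k}$ is a multiplicative $n$-ary Hom-Nambu superalgebra. Moreover, for each $1\le i\le n$, $C_i(N_{\alpha^k})=C_i(N)$. Consequently $C(N_{\alpha^k})=C(N)$, and if $N$ is complete, then $C(N_{\alpha^k})=\{0\}$.
   Context: Vector spaces are over a field $\mathbb{K}$ of characteristic zero, and $n\ge 2$. $N=N_{\bar 0}\oplus N_{\bar 1}$ is $\mathbb{Z}_2$-graded; $H(N)=N_{\bar 0}\cup N_{\bar 1}$ and $|x|$ is the parity of $x\in H(N)$. A linear map is even if it preserves the grading; an $n$-linear bracket is even if $[N_{\bar k_1},\ldots,N_{\bar k_n}]\subseteq N_{\bar k_1+\cdots+\bar k_n}$. A multiplicative $n$-ary Hom-Nambu superalgebra $(N,[\cdot,\ldots,\cdot],\alpha)$ consists of such an $N$, an even $n$-linear bracket and an even linear map $\alpha:N\to N$ (the twisting map) with $\alpha([x_1,\ldots,x_n])=[\alpha(x_1),\ldots,\alpha(x_n)]$, satisfying for homogeneous $x_i,y_j$ the super-Hom-Nambu identity $$[\alpha(x_1),\ldots,\alpha(x_{n-1}),[y_1,\ldots,y_n]]=\sum_{i=1}^n(-1)^{|X||Y|_{i-1}}[\alpha(y_1),\ldots,\alpha(y_{i-1}),[x_1,\ldots,x_{n-1},y_i],\alpha(y_{i+1}),\ldots,\alpha(y_n)],$$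 where $|X|=\sum_{k=1}^{n-1}|x_k|$ and $|Y|_{i-1}=\sum_{k=1}^{i-1}|y_k|$. The $i$-th positional center is $C_i(N)=\{z\in N: [x_1,\ldots,x_{i-1},z,x_{i+1},\ldots,x_n]=0\ \text{for all } x_j\in N\}$ (for $N_{\alpha^k}$, computed with the bracket $[\cdot,\ldots,\cdot]_{\alpha^k}$), and the center is $C(N)=\bigcap_{i=1}^nC_i(N)$. With $\alpha^0=\mathrm{id}$, for $k\ge0$ a homogeneous linear map $D:N\to N$ of parity $|D|$ is an $\alpha^k$-derivation if $D\circ\alpha=\alpha\circ D$ and $D([x_1,\ldots,x_n])=\sum_{i=1}^n(-1)^{|D|(|x_1|+\cdots+|x_{i-1}|)}[\alpha^k(x_1),\ldots,\alpha^k(x_{i-1}),D(x_i),\alpha^k(x_{i+1}),\ldots,\alpha^k(x_n)]$ for homogeneous $x_i$; $\operatorname{Der}_{\alpha^k}(N)$ is the direct sum of the spaces of even and odd $\alpha^k$-derivations. $\operatorname{Inn}_{\alpha^k}(N)\subseteq\operatorname{Der}_{\alpha^{k+1}}(N)$ is the span of the maps $y\mapsto[x_1,\ldots,x_{n-1},\alpha^k(y)]$ with $x_i\in H(N)$, $\alpha(x_i)=x_i$. $N$ is complete if $C(N)=\{0\}$ and $\operatorname{Der}_{\alpha^{k+1}}(N)=\operatorname{Inn}_{\alpha^k}(N)$ for every integer $k\ge0$. *)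

(* Defs.v *)
From HB Require Import structures.
From mathcomp Require Import all_boot all_order all_algebra.

Set Implicit Arguments.
Unset Strict Implicit.
Unset Printing Implicit Defensive.

Import GRing.Theory.
Local Open Scope ring_scope.

Section IntegerIterates.

Variables (T : choiceType) (f : T -> T) (f_bij : bijective f).

Fact bij_preimage (y : T) : exists x, f x == y.
Proof. by case: f_bij => g _ gK; exists (g y); rewrite gK. Qed.

Definition bij_inv (y : T) : T := xchoose (bij_preimage y).

Lemma bij_invKR : cancel bij_inv f.
Proof. by move=> y; apply/eqP; exact: (xchooseP (bij_preimage y)). Qed.

Lemma bij_invK : cancel f bij_inv.
Proof. by move=> x; apply: (bij_inj f_bij); rewrite bij_invKR. Qed.

Definition ziter (k : int) : T -> T :=
  match k with
  | Posz m => iter m f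
  | Negz m => iter m.+1 bij_inv
  end.

End IntegerIterates.

Section HomNambuSuperalgebras.

Variables (K : fieldType) (N : lmodType K) (n : nat).

(* The parities 0 and 1 are encoded as [false] and [true]; their sum is [(+)].
   [gr b] is the homogeneous component of parity [b].  Statements about
   homogeneous x quantify over a parity b with [gr b x], so that the zero
   vector is homogeneous of both parities. *)
Implicit Types (gr : bool -> N -> Prop) (br : {ffun 'I_n -> N} -> N).
Implicit Types (alpha D : N -> N).

Record super_grading gr : Prop := SuperGrading {
  grading0 : forall b, gr b 0;
  grading_linear : forall b (a : K) u v, gr b u -> gr b v -> gr b (a *: u + v);
  grading_span : forall x, exists u v,
    [/\ gr false u, gr true v & x = u + v];
  grading_direct : forall x, gr false x -> gr true x -> x = 0
}.

Definition has_parity gr (p : bool) (f : N -> N) : Prop :=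
  forall b x, gr b x -> gr (p (+) b) (f x).

Definition replace (x : {ffun 'I_n -> N}) (i : 'I_n) (z : N) :
    {ffun 'I_n -> N} :=
  [ffun j => if j == i then z else x j].

(* The family (x_1, ..., x_(n-1), y): the index i is sent to x_i when
   i < n - 1, in which case [insub] succeeds, and to y when i = n - 1. *)
Definition append (x : {ffun 'I_n.-1 -> N}) (y : N) : {ffun 'I_n -> N} :=
  [ffun i : 'I_n => oapp x y (insub (val i))].

Definition multilinear br : Prop :=
  forall (x : {ffun 'I_n -> N}) (i : 'I_n), linear (fun z => br (replace x i z)).

Definition even_bracket gr br : Prop :=
  forall (d : 'I_n -> bool) (x : {ffun 'I_n -> N}),
    (forall i, gr (d i) (x i)) -> gr (\big[addb/false]_(i < n) d i) (br x).

Definition super_hom_nambu_identity gr br alpha : Prop :=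
  forall (dx : 'I_n.-1 -> bool) (x : {ffun 'I_n.-1 -> N})
         (dy : 'I_n -> bool) (y : {ffun 'I_n -> N}),
    (forall k, gr (dx k) (x k)) -> (forall j, gr (dy j) (y j)) ->
    br (append [ffun k => alpha (x k)] (br y)) =
    \sum_(i < n)
      (-1) ^+ ((\sum_(k < n.-1) dx k) * (\sum_(j < n | (j < i)%N) dy j))%N *:
        br (replace [ffun j => alpha (y j)] i (br (append x (y i)))).

Record multiplicative_hom_nambu_superalgebra gr br alpha : Prop :=
  MultiplicativeHomNambuSuperalgebra {
    hns_grading : super_grading gr;
    hns_multilinear : multilinear br;
    hns_even_bracket : even_bracket gr br;
    hns_twist_linear : linear alpha;
    hns_twist_even : has_parity gr false alpha;
    hns_multiplicative : forall x, alpha (br x) = br [ffun i => alpha (x i)];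
    hns_identity : super_hom_nambu_identity gr br alpha
  }.

Definition positional_center br (i : 'I_n) (z : N) : Prop :=
  forall x : {ffun 'I_n -> N}, br (replace x i z) = 0.

Definition center br (z : N) : Prop := forall i, positional_center br i z.

Record homogeneous_derivation gr br alpha (k : nat) (p : bool) D : Prop :=
  HomogeneousDerivation {
    der_linear : linear D;
    der_parity : has_parity gr p D;
    der_commute : D \o alpha =1 alpha \o D;
    der_leibniz : forall (d : 'I_n -> bool) (x : {ffun 'I_n -> N}),
      (forall i, gr (d i) (x i)) ->
      D (br x) =
      \sum_(i < n)
        (-1) ^+ (p * (\sum_(j < n | (j < i)%N) d j))%N *:
          br (replace [ffun j => iter k alpha (x j)] i (D (x i)))
  }.

Definition Der gr br alpha (k : nat) D : Prop :=
  exists D0 D1, [/\ homogeneous_derivation gr br alpha k false D0,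
    homogeneous_derivation gr br alpha k true D1 & forall y, D y = D0 y + D1 y].

Definition Inn gr br alpha (k : nat) D : Prop :=
  exists (m : nat) (c : 'I_m -> K) (x : 'I_m -> {ffun 'I_n.-1 -> N}),
    (forall j i, (exists b, gr b (x j i)) /\ alpha (x j i) = x j i) /\
    forall y, D y = \sum_(j < m) c j *: br (append (x j) (iter k alpha y)).

Definition complete gr br alpha : Prop :=
  (forall z, center br z <-> z = 0) /\
  forall (k : nat) D, Der gr br alpha k.+1 D <-> Inn gr br alpha k D.

Definition power_bracket br alpha (alpha_bij : bijective alpha) (k : int) :
    {ffun 'I_n -> N} -> N :=
  fun x => ziter alpha_bij k (br x).

End HomNambuSuperalgebras.

(* Main.v *)
Require Import Defs.
From HB Require Import structures.
From mathcomp Require Import all_boot all_order all_algebra.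

(** The bijection [alpha] is an automorphism of all the structure at hand: it
    is linear, even, multiplicative, and commutes with itself.  These
    properties are stable under composition and under inverses, so every
    integer power [phi] of [alpha] enjoys them ([ziter_endomorphism]); only
    the evenness of the inverse needs the decomposition of [N] into its two
    homogeneous components ([endomorphism_inv]).

    The twisted algebra is then an instance of the Yau twist along such a [phi]
    ([yau_twist]), with bracket [phi \o br] and twisting map [phi \o alpha].
    Moving [phi] out of brackets by multiplicativity, each side of the twisted
    super-Hom-Nambu identity becomes [phi \o phi] applied to the corresponding
    side of the original one.

    The centers agree because [phi] is injective and fixes 0: the twisted
    bracket vanishes on a family exactly when the original one does. *)

Set Implicit Arguments.
Unset Strict Implicit.
Unset Printing Implicit Defensive.

Import GRing.Theory.
Local Open Scope ring_scope.

Section IntegerPowers.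

Variables (T : choiceType) (f : T -> T) (f_bij : bijective f).

Lemma ziter_ind (P : (T -> T) -> Prop) :
  P id -> (forall g, P g -> P (f \o g)) ->
  (forall g, P g -> P (bij_inv f_bij \o g)) ->
  forall k, P (ziter f_bij k).
Proof.
move=> P_id P_f P_inv [m | m] /=.
  by elim: m => [|m IHm] //=; exact: P_f IHm.
apply: (P_inv (iter m _)).
by elim: m => [|m IHm] //=; exact: P_inv IHm.
Qed.

Lemma ziter_add1 k x : ziter f_bij (k + 1) x = ziter f_bij k (f x).
Proof.
case: k => [m | [|m]].
- by rewrite -PoszD addn1 /= -iterS iterSr.
- by rewrite /= bij_invK.
- have ->: Negz m.+1 + 1 = Negz m by rewrite !NegzE -addn1 PoszD opprD addrNK.
  by rewrite /ziter [in RHS]iterSr bij_invK.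
Qed.

Lemma ziter_inj k : injective (ziter f_bij k).
Proof.
apply: (ziter_ind (P := fun g => injective g)) => // g g_inj.
  exact: inj_comp (bij_inj f_bij) g_inj.
exact: inj_comp (can_inj (bij_invKR f_bij)) g_inj.
Qed.

End IntegerPowers.

Section YauTwist.

Variables (K : fieldType) (N : lmodType K) (n : nat).
Variables (gr : bool -> N -> Prop) (br : {ffun 'I_n -> N} -> N).
Variable alpha : N -> N.

Record endomorphism (f : N -> N) : Prop := Endomorphism {
  endo_linear : linear f;
  endo_even : has_parity gr false f;
  endo_bracket : forall x, f (br x) = br [ffun i => f (x i)];
  endo_twist : forall x, f (alpha x) = alpha (f x)
}.

Lemma endomorphism_id : endomorphism id.
Proof.
by split=> // x; congr br; apply/ffunP => i; rewrite ffunE.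
Qed.

Lemma endomorphism_comp f g :
  endomorphism f -> endomorphism g -> endomorphism (f \o g).
Proof.
move=> Hf Hg; split=> /=.
- by move=> a u v /=; rewrite (endo_linear Hg) (endo_linear Hf).
- by move=> b x Hx; apply: (endo_even Hf (b := b)); exact: (endo_even Hg Hx).
- move=> x; rewrite (endo_bracket Hg) (endo_bracket Hf).
  by congr br; apply/ffunP => i; rewrite !ffunE.
- by move=> x; rewrite (endo_twist Hg) (endo_twist Hf).
Qed.

Lemma linear0_of (f : N -> N) : linear f -> f 0 = 0.
Proof.
move=> lin_f; pose F : {linear N -> N} :=
  HB.pack f (GRing.isLinear.Build K N N *:%R f lin_f).
exact: (linear0 F).
Qed.

Lemma linear_sumZ (f : N -> N) (I : finType) (c : I -> K) (v : I -> N) :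
  linear f -> f (\sum_i c i *: v i) = \sum_i c i *: f (v i).
Proof.
move=> lin_f; pose F : {linear N -> N} :=
  HB.pack f (GRing.isLinear.Build K N N *:%R f lin_f).
rewrite -[f]/(F : N -> N) linear_sum.
by apply: eq_bigr => i _; rewrite linearZ.
Qed.

(** The inverse is even because the sum of the homogeneous spaces is direct:
    writing the preimage of a homogeneous vector as [u + v], the image under
    [f] of the component of the wrong parity lies in both homogeneous spaces,
    hence is 0, and so is that component by injectivity. *)
Lemma endomorphism_inv f g : super_grading gr ->
  cancel f g -> cancel g f -> endomorphism f -> endomorphism g.
Proof.
move=> grN fK gK Hf; have f_inj := can_inj fK.
have f0 := linear0_of (endo_linear Hf).
split.
- by move=> a u v; apply: f_inj; rewrite (endo_linear Hf) !gK.
- move=> b x; rewrite -{1}[x]gK; move: (g x) => y {x}.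
  have [u [v [Hu Hv ->]]] := grading_span grN y.
  have Hfu := endo_even Hf Hu; have Hfv := endo_even Hf Hv.
  have fD : f (u + v) = f u + f v.
    by have := endo_linear Hf 1 u v; rewrite !scale1r.
  case: b => Hx /=.
  + have fu0 : f u = 0.
      apply: (grading_direct grN) => //.
      have -> : f u = (-1) *: f v + f (u + v).
        by rewrite fD scaleN1r addrCA addNr addr0.
      exact: grading_linear.
    by rewrite (f_inj u 0) ?add0r // f0.
  + have fv0 : f v = 0.
      apply: (grading_direct grN) => //.
      have -> : f v = (-1) *: f u + f (u + v).
        by rewrite fD scaleN1r addKr.
      exact: grading_linear.
    by rewrite (f_inj v 0) ?addr0 // f0.
- move=> x; apply: f_inj; rewrite gK (endo_bracket Hf).
  by congr br; apply/ffunP => i; rewrite !ffunE gK.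
- by move=> x; apply: f_inj; rewrite (endo_twist Hf) !gK.
Qed.

Lemma twist_endomorphism :
  multiplicative_hom_nambu_superalgebra gr br alpha -> endomorphism alpha.
Proof. by case. Qed.

Lemma ziter_endomorphism (alpha_bij : bijective alpha) k :
  multiplicative_hom_nambu_superalgebra gr br alpha ->
  endomorphism (ziter alpha_bij k).
Proof.
move=> HN; have Ha := twist_endomorphism HN.
apply: ziter_ind; first exact: endomorphism_id.
  by move=> g; exact: endomorphism_comp.
move=> g; apply: endomorphism_comp.
apply: (endomorphism_inv (hns_grading HN) _ _ Ha).
  exact: bij_invK.
exact: bij_invKR.
Qed.

Lemma map_replace (f : N -> N) (x : {ffun 'I_n -> N}) i z :
  [ffun j => f (replace x i z j)] = replace [ffun j => f (x j)] i (f z).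
Proof. by apply/ffunP => j; rewrite !ffunE; case: eqP. Qed.

Lemma map_append (f : N -> N) (x : {ffun 'I_n.-1 -> N}) y :
  [ffun j => f (append x y j)] = append [ffun j => f (x j)] (f y).
Proof.
by apply/ffunP => j; rewrite !ffunE; case: insub => [l|] //=; rewrite ffunE.
Qed.

(** In the identity, [phi] is moved out of every inner bracket and every
    argument, which leaves [phi (phi _)] around each term of the original
    identity; the signs are scalars, hence pass through the linear map [phi]. *)
Lemma yau_twist phi :
  multiplicative_hom_nambu_superalgebra gr br alpha -> endomorphism phi ->
  multiplicative_hom_nambu_superalgebra gr (phi \o br) (phi \o alpha).
Proof.
move=> HN Hphi; have Ha := twist_endomorphism HN.
have Hpa := endomorphism_comp Hphi Ha.
split.
- exact: hns_grading HN.
- by move=> x i a u v /=; rewrite (hns_multilinear HN) (endo_linear Hphi).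
- move=> d x Hx; apply: (endo_even Hphi (b := \big[addb/false]_(i < n) d i)).
  exact: (hns_even_bracket HN Hx).
- exact: endo_linear Hpa.
- exact: endo_even Hpa.
- by move=> x /=; rewrite -(endo_twist Hphi) -(endo_bracket Hpa).
- move=> dx x dy y Hx Hy /=.
  have -> : append [ffun l => phi (alpha (x l))] (phi (br y)) =
      [ffun j => phi (append [ffun l => alpha (x l)] (br y) j)].
    rewrite map_append; congr append.
    by apply/ffunP => l; rewrite !ffunE.
  rewrite -(endo_bracket Hphi) (hns_identity HN Hx Hy).
  rewrite !(linear_sumZ _ _ (endo_linear Hphi)).
  apply: eq_bigr => i _; congr (_ *: phi _).
  rewrite (endo_bracket Hphi) map_replace; congr (br (replace _ _ _)).
  by apply/ffunP => j; rewrite !ffunE.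
Qed.

Lemma positional_center_comp phi i z : injective phi -> phi 0 = 0 ->
  positional_center (phi \o br) i z <-> positional_center br i z.
Proof.
move=> phi_inj phi0; split=> Hz x; last by rewrite /= Hz.
by apply: phi_inj; rewrite phi0; exact: Hz.
Qed.

Lemma eq_twist (alpha' : N -> N) : alpha =1 alpha' ->
  multiplicative_hom_nambu_superalgebra gr br alpha ->
  multiplicative_hom_nambu_superalgebra gr br alpha'.
Proof.
move=> eq_a [grN mul_br even_br lin_a even_a mult_a ident].
have eq_map m (x : {ffun 'I_m -> N}) :
    [ffun i => alpha' (x i)] = [ffun i => alpha (x i)].
  by apply/ffunP => i; rewrite !ffunE eq_a.
split=> //.
- by move=> a u v; rewrite -!eq_a lin_a.
- by move=> b x Hx; rewrite -eq_a; exact: even_a.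
- by move=> x; rewrite -eq_a mult_a eq_map.
- move=> dx x dy y Hx Hy; rewrite eq_map (ident _ _ _ _ Hx Hy).
  by apply: eq_bigr => i _; rewrite eq_map.
Qed.

End YauTwist.

Theorem proposition3p20 (K : fieldType) (charK0 : [pchar K] =i pred0)
    (N : lmodType K) (n : nat) (n_ge2 : (2 <= n)%N)
    (gr : bool -> N -> Prop) (br : {ffun 'I_n -> N} -> N) (alpha : N -> N)
    (HN : multiplicative_hom_nambu_superalgebra gr br alpha)
    (alpha_bij : bijective alpha) (k : int) :
  [/\ multiplicative_hom_nambu_superalgebra gr
        (power_bracket br alpha_bij k) (ziter alpha_bij (k + 1)),
      forall (i : 'I_n) (z : N),
        positional_center (power_bracket br alpha_bij k) i z <->
        positional_center br i z,
      forall z : N, center (power_bracket br alpha_bij k) z <-> center br z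
    & complete gr br alpha ->
      forall z : N, center (power_bracket br alpha_bij k) z <-> z = 0].
Proof.
have Hphi := ziter_endomorphism alpha_bij k HN.
have pcE (i : 'I_n) z : positional_center (power_bracket br alpha_bij k) i z <->
    positional_center br i z.
  apply: positional_center_comp; first exact: ziter_inj.
  exact: linear0_of (endo_linear Hphi).
have cE z : center (power_bracket br alpha_bij k) z <-> center br z.
  by split=> Hz i; apply/pcE.
split=> //.
- apply: eq_twist (yau_twist HN Hphi) => x.
  by rewrite ziter_add1.
- by move=> [c0 _] z; exact: iff_trans (cE z) (c0 z).
Qed.
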